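(* Let $\eta(x)$, $x\in\mathbb{R}$, be a real, measurable, mean-square continuous, weakly (second-order) stationary, centered stochastic process on a complete probability space, with spectral measure $F$ and orthogonal random spectral measure $Z$, and let $$u(t,x)=\int_{\mathbb{R}}\exp\{i\lambda x+i\lambda^3t\}\,Z(d\lambda)$$ be the mean-square solution of the Airy equation $\partial u/\partial t=-\partial^3u/\partial x^3$ with initial condition $u(0,x)=\eta(x)$. Let $K=[a,b]\times[c,d]$ with $a\ge 0$ and $b,c,d\in\mathbb{R}$ ($a\le b$, $c\le d$). Suppose that for some $\beta\in(0,1]$ $$\int_{\mathbb{R}}|\lambda|^{6\beta}\,F(d\lambda)<\infty.$$ Then for every $h>0$ $$\sigma(h):=\sup_{\substack{(t,x),(s,y)\in K:\\ |t-s|\le h,\ |x-y|\le h}}\Big(\mathsf{E}\,(u(t,x)-u(s,y))^2\Big)^{1/2}\le c(\beta)\,h^{\beta},$$ where $$c(\beta)=2^{1-\beta}\Big(\int_{\mathbb{R}}|\lambda+\lambda^3|^{2\beta}\,F(d\lambda)\Big)^{1/2}.$$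
   Context: The covariance function of $\eta$ is $B_\eta(x)=\int_{\mathbb{R}}\cos(\lambda x)\,dF(\lambda)$, where the spectral measure $F$ is a finite (symmetric) Borel measure on $\mathbb{R}$. The process has the spectral representation $\eta(x)=\int_{\mathbb{R}}e^{i\lambda x}Z(d\lambda)$ (an $L_2(\Omega)$ stochastic integral), where $Z$ is a complex-valued orthogonal random measure with $\mathsf{E}|Z(d\lambda)|^2=F(d\lambda)$. The field $u(t,x)$, $t\ge 0$, $x\in\mathbb{R}$, is defined by the displayed $L_2(\Omega)$ stochastic integral; it is real-valued. *)

(* Defs.v *)
From HB Require Import structures.
From mathcomp Require Import all_boot all_order all_algebra.
From mathcomp Require Import complex.
From mathcomp Require Import all_classical all_reals all_analysis.

Set Implicit Arguments.
Unset Strict Implicit.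
Unset Printing Implicit Defensive.

Import Order.TTheory GRing.Theory Num.Theory.
Import numFieldNormedType.Exports.
Import ComplexField.Normc.

Local Open Scope classical_set_scope.
Local Open Scope ring_scope.
Local Open Scope complex_scope.

(** Complex-valued square-integrable functions.  [R[i]] carries no
    sigma-algebra in the libraries: measurability is that of both parts. *)

Definition complex_L2 (R : realType) (d : measure_display)
    (T : measurableType d) (mu : {measure set T -> \bar R})
    (f : T -> R[i]) : Prop :=
  [/\ measurable_fun setT (fun w => complex.Re (f w)),
      measurable_fun setT (fun w => complex.Im (f w)) &
      (\int[mu]_w ((normc (f w)) ^+ 2)%:E < +oo)%E].

Definition sqdist_L2 (R : realType) (d : measure_display)
    (T : measurableType d) (mu : {measure set T -> \bar R})
    (f g : T -> R[i]) : \bar R :=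
  (\int[mu]_w ((normc (f w - g w)) ^+ 2)%:E)%E.

Definition complex_expectation (R : realType) (d : measure_display)
    (T : measurableType d) (P : probability T R) (X : T -> R[i]) : R[i] :=
  (\int[P]_w complex.Re (X w))%R +i* (\int[P]_w complex.Im (X w))%R.

Definition expi (R : realType) (theta : R) : R[i] := cos theta +i* sin theta.

(** Second-order processes indexed by the real line. *)

Definition process (R : realType) (d : measure_display)
    (T : measurableType d) (P : probability T R) := R -> {RV P >-> R}.

Definition measurable_process (R : realType) (d : measure_display)
    (T : measurableType d) (P : probability T R) (eta : process P) : Prop :=
  measurable_fun setT (fun p : measurableTypeR R * T => eta p.1 p.2).

Definition second_order (R : realType) (d : measure_display)
    (T : measurableType d) (P : probability T R) (eta : process P) : Prop :=
  forall x, ('E_P[(fun w => (eta x w) ^+ 2)%R] < +oo)%E.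

Definition ms_continuous (R : realType) (d : measure_display)
    (T : measurableType d) (P : probability T R) (eta : process P) : Prop :=
  forall x0 : R,
    'E_P[(fun w => (eta x w - eta x0 w) ^+ 2)%R]%E @[x --> x0] --> 0%E.

Definition centered (R : realType) (d : measure_display)
    (T : measurableType d) (P : probability T R) (eta : process P) : Prop :=
  forall x, ('E_P[eta x] = 0)%E.

Definition weakly_stationary (R : realType) (d : measure_display)
    (T : measurableType d) (P : probability T R) (eta : process P) : Prop :=
  [/\ second_order eta,
      forall x y, ('E_P[eta x] = 'E_P[eta y])%E &
      forall x y z, covariance P (eta (x + z)) (eta (y + z))
                    = covariance P (eta x) (eta y)].

Definition cov_fun (R : realType) (d : measure_display)
    (T : measurableType d) (P : probability T R) (eta : process P) (x : R)
    : \bar R :=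
  covariance P (eta x) (eta 0).

Definition spectral_measure (R : realType) (d : measure_display)
    (T : measurableType d) (P : probability T R) (eta : process P)
    (F : {finite_measure set (measurableTypeR R) -> \bar R}) : Prop :=
  (forall A : set (measurableTypeR R), measurable A ->
     F ((fun l : R => - l) @^-1` A) = F A) /\
  (forall x : R, cov_fun eta x = (\int[F]_l (cos (l * x))%:E)%E).

(** Orthogonal random measures; only the values of [Z] on Borel sets matter. *)

Record orthogonal_random_measure (R : realType) (d : measure_display)
    (T : measurableType d) (P : probability T R)
    (F : {finite_measure set (measurableTypeR R) -> \bar R})
    (Z : set (measurableTypeR R) -> T -> R[i]) : Prop := {
  orm_L2 : forall A, measurable A -> complex_L2 P (Z A) ;
  orm_sigma_additive : forall A : nat -> set (measurableTypeR R),
    (forall n, measurable (A n)) -> trivIset setT A ->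
    sqdist_L2 P (Z (\bigcup_n A n)) (fun w => \sum_(k < n) Z (A k) w)
      @[n --> \oo] --> 0%E ;
  orm_orthogonal : forall A B, measurable A -> measurable B ->
    A `&` B = set0 ->
    complex_expectation P (fun w => Z A w * (Z B w)^*) = 0 ;
  orm_control : forall A, measurable A ->
    (\int[P]_w ((normc (Z A w)) ^+ 2)%:E)%E = F A }.

(** The list [s] of pairs [(c, A)] stands for the Borel simple function
    [\sum c * 1_A]; [simple_int] is its integral [\sum c * Z A]. *)

Definition simple_repr (R : realType) := seq (R[i] * set (measurableTypeR R)).

Definition measurable_repr (R : realType) (s : simple_repr R) : Prop :=
  forall k, (k < size s)%N -> measurable (nth (0, set0) s k).2.

Definition simple_fun (R : realType) (s : simple_repr R)
    (l : measurableTypeR R) : R[i] :=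
  \sum_(cA <- s) cA.1 * (\1_(cA.2) l : R)%:C.

Definition simple_int (R : realType) (T : Type)
    (Z : set (measurableTypeR R) -> T -> R[i]) (s : simple_repr R) (w : T)
    : R[i] :=
  \sum_(cA <- s) cA.1 * Z cA.2 w.

(** [X] is (a version of) the stochastic integral of [f] against [Z]: the
    mean-square limit of integrals of simple functions tending to [f] in
    [L^2(F)].  Versions are determined up to almost sure equality. *)

Definition is_stoch_integral (R : realType) (d : measure_display)
    (T : measurableType d) (P : probability T R)
    (F : {finite_measure set (measurableTypeR R) -> \bar R})
    (Z : set (measurableTypeR R) -> T -> R[i])
    (f : measurableTypeR R -> R[i]) (X : T -> R[i]) : Prop :=
  [/\ complex_L2 F f, complex_L2 P X &
   exists s : nat -> simple_repr R,
    [/\ forall n, measurable_repr (s n),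
        sqdist_L2 F f (simple_fun (s n)) @[n --> \oo] --> 0%E &
        sqdist_L2 P X (simple_int Z (s n)) @[n --> \oo] --> 0%E]].

Definition spectral_representation (R : realType) (d : measure_display)
    (T : measurableType d) (P : probability T R) (eta : process P)
    (F : {finite_measure set (measurableTypeR R) -> \bar R})
    (Z : set (measurableTypeR R) -> T -> R[i]) : Prop :=
  forall x : R, is_stoch_integral P F Z (fun l : R => expi (l * x))
                                        (fun w => (eta x w)%:C).

(** The real field [u] on [t >= 0] given by the Airy stochastic integral. *)

Definition airy_field (R : realType) (d : measure_display)
    (T : measurableType d) (P : probability T R)
    (F : {finite_measure set (measurableTypeR R) -> \bar R})
    (Z : set (measurableTypeR R) -> T -> R[i])
    (u : R -> R -> {RV P >-> R}) : Prop :=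
  forall t x : R, 0 <= t ->
    is_stoch_integral P F Z (fun l : R => expi (l * x + l ^+ 3 * t))
                            (fun w => (u t x w)%:C).

Definition ms_modulus (R : realType) (d : measure_display)
    (T : measurableType d) (P : probability T R)
    (u : R -> R -> {RV P >-> R}) (K : set (R * R)) (h : R) : \bar R :=
  ereal_sup [set e : \bar R | exists t x s y : R,
    [/\ K (t, x), K (s, y), `|t - s| <= h, `|x - y| <= h &
        e = sqrte 'E_P[(fun w => (u t x w - u s y w) ^+ 2)%R]%E]].

Definition airy_const (R : realType)
    (F : {finite_measure set (measurableTypeR R) -> \bar R}) (beta : R)
    : \bar R :=
  ((2 `^ (1 - beta))%:E *
   sqrte (\int[F]_l (`|l + l ^+ 3| `^ (2 * beta))%:E))%E.

(* Main.v *)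
Require Import Defs.
From HB Require Import structures.
From mathcomp Require Import all_boot all_order all_algebra.
From mathcomp Require Import complex ring lra.
From mathcomp Require Import all_classical all_reals all_analysis.
From mathcomp Require Import measurable_realfun.

(** The increment [u t x - u s y] is the stochastic integral of
    [e^(i p) - e^(i q)], where [p = l x + l^3 t] and [q = l y + l^3 s], so its
    second moment is at most [\int |e^(i p) - e^(i q)|^2 dF] (in fact equal to
    it).  Pointwise, [|e^(i p) - e^(i q)| = 2 |sin ((p - q) / 2)|], and
    [|sin z| <= |z|^beta] for [0 < beta <= 1], which gives the bound
    [2^(1 - beta) |p - q|^beta]; when both increments of the arguments are at
    most [h], [|p - q| <= h (|l| + |l|^3) = h |l + l^3|].  Integrating and
    taking square roots yields the constant of the theorem.

    The substance is the comparison of second moments,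
    [stoch_integral_sqdist_le].  An orthogonal random measure is
    almost surely additive ([orm_additive]), because sigma-additivity can be
    applied to [A, B, set0, set0, ...] and [Z set0] vanishes in mean square.
    Splitting [A] and [B] along [A `&` B] and using orthogonality, the inner
    product of [Z A] and [Z B] is [F (A `&` B)] ([ip_orm]), that is, the inner
    product of the two indicators in [L^2(F)] ([ip_indic]).  By
    sesquilinearity the integral of simple functions is an isometry
    ([sqnorm_simple_int]), and the inequality passes to mean-square limits.

    For that passage, the pointwise estimate
    [|z + w|^2 <= (1 + e) |z|^2 + (1 + 1/e) |w|^2] integrates to a triangle
    inequality for squared norms that is exact up to the factor [1 + e],
    and [e] tends to [0] after the limit along the simple functions. *)

Import Order.TTheory GRing.Theory Num.Theory.
Import numFieldNormedType.Exports.
Import ComplexField.Normc.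

Local Open Scope classical_set_scope.
Local Open Scope ring_scope.

(** * The modulus of complex numbers *)

Section complex_modulus.
Set Implicit Arguments.
Unset Strict Implicit.
Context {R : realType}.
Implicit Types z w : R[i].

Lemma ReD z w : complex.Re (z + w) = complex.Re z + complex.Re w.
Proof. by case: z w => [a b] [c d]. Qed.

Lemma ImD z w : complex.Im (z + w) = complex.Im z + complex.Im w.
Proof. by case: z w => [a b] [c d]. Qed.

Lemma ReM z w :
  complex.Re (z * w)
  = complex.Re z * complex.Re w - complex.Im z * complex.Im w.
Proof. by case: z w => [a b] [c d]. Qed.

Lemma ImM z w :
  complex.Im (z * w)
  = complex.Re z * complex.Im w + complex.Im z * complex.Re w.
Proof. by case: z w => [a b] [c d]. Qed.

Lemma ReJ z : complex.Re z^*%C = complex.Re z.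
Proof. by case: z. Qed.

Lemma ImJ z : complex.Im z^*%C = - complex.Im z.
Proof. by case: z. Qed.

Lemma normc_sqr z : normc z ^+ 2 = complex.Re z ^+ 2 + complex.Im z ^+ 2.
Proof. by case: z => a b; rewrite sqr_sqrtr// addr_ge0 ?sqr_ge0. Qed.

Lemma mul_conjc_sqr z : z * z^*%C = (normc z ^+ 2)%:C%C.
Proof.
rewrite normc_sqr; apply/eqP; rewrite eq_complex ReM ImM ReJ ImJ /=.
by apply/andP; split; apply/eqP; ring.
Qed.

(** Young's inequality on the cross term.  The free parameter [e] lets a small
    perturbation [w] be absorbed at a cost [1 + e] arbitrarily close to [1]. *)
Lemma normc_sqrD_le z w (e : R) : 0 < e ->
  normc (z + w) ^+ 2 <= (1 + e) * normc z ^+ 2 + (1 + e^-1) * normc w ^+ 2.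
Proof.
move=> e0; rewrite !normc_sqr ReD ImD.
have young x y : (x + y) ^+ 2 <= (1 + e) * x ^+ 2 + (1 + e^-1) * y ^+ 2.
  rewrite -subr_ge0 [leRHS](_ : _ = e * (x - e^-1 * y) ^+ 2); last first.
    by field; rewrite gt_eqF.
  by rewrite mulr_ge0 ?sqr_ge0// ltW.
by rewrite (le_trans (lerD (young _ _) (young _ _)))// !mulrDr addrACA.
Qed.

End complex_modulus.

(** * Square-integrable complex functions *)

Definition sqnorm {R : realType} {d : measure_display} {T : measurableType d}
    (mu : {measure set T -> \bar R}) (f : T -> R[i]) : \bar R :=
  (\int[mu]_w ((normc (f w)) ^+ 2)%:E)%E.

Section square_integrable.
Set Implicit Arguments.
Unset Strict Implicit.
Context {R : realType} {d : measure_display} {T : measurableType d}.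
Variable mu : {measure set T -> \bar R}.
Implicit Types f g h : T -> R[i].

Definition measurable_parts f :=
  measurable_fun setT (fun w => complex.Re (f w)) /\
  measurable_fun setT (fun w => complex.Im (f w)).

Lemma complex_L2_parts f : complex_L2 mu f -> measurable_parts f.
Proof. by case. Qed.

Lemma measurable_normc_sqr f : measurable_parts f ->
  measurable_fun setT (fun w => normc (f w) ^+ 2).
Proof.
move=> [mr mi]; under eq_fun do rewrite normc_sqr.
by apply: measurable_funD; apply: measurable_funX.
Qed.

Lemma measurable_partsD f g : measurable_parts f -> measurable_parts g ->
  measurable_parts (fun w => f w + g w).
Proof.
move=> [fr fi] [gr gi]; split; [under eq_fun do rewrite ReD |
  under eq_fun do rewrite ImD]; exact: measurable_funD.
Qed.

Lemma measurable_partsM f g : measurable_parts f -> measurable_parts g ->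
  measurable_parts (fun w => f w * g w).
Proof.
move=> [fr fi] [gr gi]; split; [under eq_fun do rewrite ReM |
  under eq_fun do rewrite ImM].
  by apply: measurable_funB; apply: measurable_funM.
by apply: measurable_funD; apply: measurable_funM.
Qed.

Lemma measurable_partsJ f : measurable_parts f ->
  measurable_parts (fun w => (f w)^*%C).
Proof.
move=> [fr fi]; split; [under eq_fun do rewrite ReJ |
  under eq_fun do rewrite ImJ] => //.
exact: measurableT_comp.
Qed.

Lemma sqnorm_ge0 f : (0 <= sqnorm mu f)%E.
Proof. by apply: integral_ge0 => w _; rewrite lee_fin sqr_ge0. Qed.

Lemma complex_L2_fin f : complex_L2 mu f -> sqnorm mu f \is a fin_num.
Proof. by case=> _ _ ?; rewrite ge0_fin_numE// sqnorm_ge0. Qed.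

Lemma sqnormD_le f g (e : R) : 0 < e ->
  measurable_parts f -> measurable_parts g ->
  (sqnorm mu (fun w => f w + g w)%R
   <= (1 + e)%:E * sqnorm mu f + (1 + e^-1)%:E * sqnorm mu g)%E.
Proof.
move=> e0 mf mg.
have e1 : 0 <= 1 + e by rewrite addr_ge0// ltW.
have e2 : 0 <= 1 + e^-1 by rewrite addr_ge0// invr_ge0 ltW.
have mE k : measurable_parts k ->
    measurable_fun setT (fun w => ((normc (k w)) ^+ 2)%:E).
  by move=> mk; apply/measurable_EFinP; exact: measurable_normc_sqr.
have sE (k : T -> R[i]) w : setT w -> (0 <= ((normc (k w)) ^+ 2)%:E)%E.
  by move=> _; rewrite lee_fin sqr_ge0.
rewrite /sqnorm -!ge0_integralZl_EFin//; [|exact: sE|exact: mE|exact: sE|exact: mE].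
rewrite -ge0_integralD//; last 4 first.
- by move=> w _; rewrite mule_ge0// ?lee_fin// sqr_ge0.
- by apply: emeasurable_funM => //; exact: mE.
- by move=> w _; rewrite mule_ge0// ?lee_fin// sqr_ge0.
- by apply: emeasurable_funM => //; exact: mE.
apply: ge0_le_integral => //.
- exact: sE.
- by apply: mE; exact: measurable_partsD.
- by apply: emeasurable_funD; apply: emeasurable_funM => //; exact: mE.
- by move=> w _; rewrite -!EFinM -EFinD lee_fin normc_sqrD_le.
Qed.

Lemma sqnormZ (c : R[i]) f : measurable_parts f ->
  sqnorm mu (fun w => c * f w)%R = ((normc c ^+ 2)%:E * sqnorm mu f)%E.
Proof.
move=> mf; rewrite /sqnorm -ge0_integralZl_EFin// ?sqr_ge0//.
- by apply: eq_integral => w _; rewrite normcM exprMn EFinM.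
- by move=> w _; rewrite lee_fin sqr_ge0.
- by apply/measurable_EFinP; exact: measurable_normc_sqr.
Qed.

Lemma complex_L2D f g : complex_L2 mu f -> complex_L2 mu g ->
  complex_L2 mu (fun w => f w + g w).
Proof.
move=> Lf Lg; have [mf mg] := (complex_L2_parts Lf, complex_L2_parts Lg).
have [? ?] := measurable_partsD mf mg; split => //.
apply: le_lt_trans (sqnormD_le ltr01 mf mg) _.
by rewrite -ge0_fin_numE ?adde_ge0 ?mule_ge0 ?sqnorm_ge0 ?lee_fin ?addr_ge0 ?invr_ge0//
  fin_numD !fin_numM// complex_L2_fin.
Qed.

Lemma complex_L2Z (c : R[i]) f : complex_L2 mu f ->
  complex_L2 mu (fun w => c * f w).
Proof.
move=> Lf; have mf := complex_L2_parts Lf.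
have mc : measurable_parts (fun=> c : R[i]) by split; exact: measurable_cst.
have [? ?] := measurable_partsM mc mf; split => //.
rewrite -/(sqnorm _ _) sqnormZ// -ge0_fin_numE ?mule_ge0 ?sqnorm_ge0 ?lee_fin ?sqr_ge0//.
by rewrite fin_numM// complex_L2_fin.
Qed.

Lemma complex_L2B f g : complex_L2 mu f -> complex_L2 mu g ->
  complex_L2 mu (fun w => f w - g w).
Proof.
move=> Lf Lg; have := complex_L2D Lf (complex_L2Z (-1) Lg).
by under eq_fun do rewrite mulN1r.
Qed.

Lemma sqdist_L2C f g : sqdist_L2 mu f g = sqdist_L2 mu g f.
Proof. by apply: eq_integral => w _; rewrite -normcN opprB. Qed.

(** A triangle inequality along [f, a, b, g] in which the middle distance
    keeps a coefficient close to [1]; the constant [4 * r] collects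
    [2 * r + 2 * r] from splitting [(f - a) + (b - g)] with [e = 1]. *)
Lemma sqdist_L2_perturb f g a b (e r : R) : 0 < e ->
  complex_L2 mu f -> complex_L2 mu g -> complex_L2 mu a -> complex_L2 mu b ->
  (sqdist_L2 mu f a <= r%:E)%E -> (sqdist_L2 mu g b <= r%:E)%E ->
  (sqdist_L2 mu f g
   <= (1 + e)%:E * sqdist_L2 mu a b + ((1 + e^-1) * (4 * r))%:E)%E.
Proof.
move=> e0 Lf Lg La Lb far gbr.
have mab := complex_L2_parts (complex_L2B La Lb).
have mfa := complex_L2_parts (complex_L2B Lf La).
have mbg := complex_L2_parts (complex_L2B Lb Lg).
have := sqnormD_le e0 mab (measurable_partsD mfa mbg).
have -> : sqnorm mu (fun w => a w - b w + (f w - a w + (b w - g w)))%R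
    = sqdist_L2 mu f g.
  by apply: eq_integral => w _; congr ((normc _ ^+ 2)%:E); ring.
move/le_trans; apply; rewrite leeD2l// EFinM lee_wpmul2l//.
  by rewrite lee_fin addr_ge0// invr_ge0 ltW.
apply: (le_trans (sqnormD_le ltr01 mfa mbg)).
have -> : (4 * r)%:E = ((1 + 1)%:E * r%:E + (1 + 1^-1)%:E * r%:E)%E.
  by rewrite -!EFinM -EFinD; congr (_%:E); field.
apply: leeD; apply: lee_wpmul2l => //; rewrite ?lee_fin ?addr_ge0 ?invr_ge0//.
by rewrite -[sqnorm _ _]/(sqdist_L2 mu b g) sqdist_L2C.
Qed.

Lemma complex_L20 : complex_L2 mu (fun=> 0).
Proof.
split; [exact: measurable_cst|exact: measurable_cst|].
by under eq_integral do rewrite normc0 expr0n/=; rewrite integral0.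
Qed.

(** The inner product of [L^2(mu)]; for a probability measure it is
    [complex_expectation] of [f * g^*], by conversion. *)
Definition ip f g : R[i] :=
  ((\int[mu]_w complex.Re (f w * (g w)^*%C))%R
   +i* (\int[mu]_w complex.Im (f w * (g w)^*%C))%R)%C.

Lemma le_sqnorm_integrable (k : T -> R) f g :
  complex_L2 mu f -> complex_L2 mu g -> measurable_fun setT k ->
  (forall w, `|k w| <= normc (f w) ^+ 2 + normc (g w) ^+ 2) ->
  mu.-integrable setT (EFin \o k).
Proof.
move=> Lf Lg mk kle.
have iE q : complex_L2 mu q ->
    mu.-integrable setT (EFin \o (fun w => normc (q w) ^+ 2)).
  move=> Lq; have mq := complex_L2_parts Lq; apply/integrableP; split.
    by apply/measurable_EFinP; exact: measurable_normc_sqr.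
  case: Lq => _ _ /=; under [X in (X < _)%E -> _]eq_integral => w _.
    by rewrite -[X in X%:E]ger0_norm ?sqr_ge0//; over.
  by [].
apply: (@le_integrable _ _ _ mu _ measurableT _
  (fun w => ((normc (f w) ^+ 2)%:E + (normc (g w) ^+ 2)%:E)%E)).
- exact/measurable_EFinP.
- by move=> w _ /=; rewrite lee_fin (le_trans (kle w))// ler_norm.
- by apply: integrableD => //; exact: iE.
Qed.

(** Both parts of [f * g^*] are dominated by [|f|^2 + |g|^2], so the totalized
    real integral in [ip] is a genuine one, and linear. *)
Lemma ip_integrable f g : complex_L2 mu f -> complex_L2 mu g ->
  mu.-integrable setT (EFin \o (fun w => complex.Re (f w * (g w)^*%C))) /\
  mu.-integrable setT (EFin \o (fun w => complex.Im (f w * (g w)^*%C))).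
Proof.
move=> Lf Lg; have [mf mg] := (complex_L2_parts Lf, complex_L2_parts Lg).
have [mr mi] := measurable_partsM mf (measurable_partsJ mg).
have young (x y z t : R) :
    `|x * z + y * t| <= (x ^+ 2 + y ^+ 2) + (z ^+ 2 + t ^+ 2).
  have := (sqr_ge0 (x + z), sqr_ge0 (x - z), sqr_ge0 (y + t), sqr_ge0 (y - t)).
  move=> [[[]]]; have := (sqr_ge0 x, sqr_ge0 y, sqr_ge0 z, sqr_ge0 t).
  by move=> [[[]]]; rewrite ler_norml => *; apply/andP; split; nra.
split; apply: (le_sqnorm_integrable Lf Lg) => // w; rewrite !normc_sqr.
- by rewrite ReM ReJ ImJ mulrN opprK young.
- rewrite ImM ReJ ImJ mulrN -mulNr addrC (le_trans (young _ _ _ _))//.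
  by rewrite sqrrN [X in X + _ <= _]addrC.
Qed.

Lemma ip_conj f g : complex_L2 mu f -> complex_L2 mu g ->
  ip g f = (ip f g)^*%C.
Proof.
move=> Lf Lg; have [_ Ii] := ip_integrable Lf Lg.
apply/eqP; rewrite eq_complex ReJ ImJ /=; apply/andP; split; apply/eqP.
  by apply: eq_Rintegral => w _; rewrite !ReM !ReJ !ImJ; ring.
rewrite -mulN1r -RintegralZl//; apply: eq_Rintegral => w _.
by rewrite !ImM !ReJ !ImJ; ring.
Qed.

Lemma ip_linear (c : R[i]) f g h :
  complex_L2 mu f -> complex_L2 mu g -> complex_L2 mu h ->
  ip (fun w => c * f w + g w) h = c * ip f h + ip g h.
Proof.
move=> Lf Lg Lh.
have [fr fi] := ip_integrable Lf Lh; have [gr gi] := ip_integrable Lg Lh.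
apply/eqP; rewrite eq_complex ReD ImD ReM ImM /=.
have iZ (a : R) k : mu.-integrable setT (EFin \o k) ->
    mu.-integrable setT (EFin \o (fun w => a * k w)).
  by move=> ik; have := integrableZl measurableT a ik.
have iB k1 k2 : mu.-integrable setT (EFin \o k1) ->
    mu.-integrable setT (EFin \o k2) ->
    mu.-integrable setT (EFin \o (fun w => k1 w - k2 w)).
  by move=> i1 i2; have := integrableB measurableT i1 i2.
have iD k1 k2 : mu.-integrable setT (EFin \o k1) ->
    mu.-integrable setT (EFin \o k2) ->
    mu.-integrable setT (EFin \o (fun w => k1 w + k2 w)).
  by move=> i1 i2; have := integrableD measurableT i1 i2.
apply/andP; split; apply/eqP.
- rewrite -!RintegralZl// -RintegralB//; [|exact: iZ..].
  rewrite -RintegralD//; last by apply: iB; exact: iZ.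
  by apply: eq_Rintegral => w _; rewrite !(ReM, ImM, ReD, ImD, ReJ, ImJ); ring.
- rewrite -!RintegralZl// -RintegralD//; [|exact: iZ..].
  rewrite -RintegralD//; last by apply: iD; exact: iZ.
  by apply: eq_Rintegral => w _; rewrite !(ReM, ImM, ReD, ImD, ReJ, ImJ); ring.
Qed.

Lemma ip0l g : ip (fun=> 0) g = 0.
Proof.
rewrite /ip /Rintegral; apply/eqP; rewrite eq_complex /=.
by under eq_integral do rewrite mul0r/=; rewrite integral0 eqxx;
   under eq_integral do rewrite mul0r/=; rewrite integral0/=.
Qed.

Lemma ip_self f : complex_L2 mu f -> ip f f = (fine (sqnorm mu f))%:C%C.
Proof.
move=> Lf; rewrite /ip /Rintegral; congr (_ +i* _)%C.
  by congr fine; apply: eq_integral => w _; rewrite mul_conjc_sqr.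
by under eq_integral do rewrite mul_conjc_sqr/=; rewrite integral0.
Qed.

(** A function at squared distance [0] is almost everywhere equal, so it can
    be exchanged inside an inner product. *)
Lemma ip_ae_eql f f' g :
  complex_L2 mu f -> complex_L2 mu f' -> complex_L2 mu g ->
  sqnorm mu (fun w => f w - f' w)%R = 0%E -> ip f g = ip f' g.
Proof.
move=> Lf Lf' Lg ff'.
have mD : measurable_parts (fun w => f w - f' w).
  have /complex_L2_parts := complex_L2D Lf (complex_L2Z (-1) Lf').
  by under eq_fun do rewrite mulN1r.
have : ae_eq mu setT (fun w => ((normc (f w - f' w)) ^+ 2)%:E) (cst 0%E).
  apply/ae_eq_integral_abs => //.
    by apply/measurable_EFinP; exact: measurable_normc_sqr.
  by rewrite -ff'; apply: eq_integral => w _; rewrite gee0_abs// lee_fin sqr_ge0.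
move=> ae0.
have aeff' : {ae mu, forall w, f w = f' w}.
  apply: filterS ae0 => w /(_ I)[] /eqP.
  by rewrite sqrf_eq0 => /eqP/eq0_normc/eqP; rewrite subr_eq0 => /eqP.
have [/measurable_int fr /measurable_int fi] := ip_integrable Lf Lg.
have [/measurable_int f'r /measurable_int f'i] := ip_integrable Lf' Lg.
rewrite /ip /Rintegral; congr (fine _ +i* fine _)%C.
- by apply: ae_eq_integral => //; apply: filterS aeff' => w /= -> _.
- by apply: ae_eq_integral => //; apply: filterS aeff' => w /= -> _.
Qed.

End square_integrable.

(** * The isometry of the stochastic integral *)

Section orthogonal_measure.
Set Implicit Arguments.
Unset Strict Implicit.

Lemma cvge0_near_le (R : realType) (v : nat -> \bar R) (e : R) : 0 < e ->
  v n @[n --> \oo] --> 0%E -> \forall n \near \oo, (v n <= e%:E)%E.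
Proof.
move=> e0 /(_ [set x | (x < e%:E)%E]) v0.
have /v0 : nbhs (0%E : \bar R) [set x | (x < e%:E)%E].
  by have := @open_ereal_lt' R 0%E e%:E; rewrite lte_fin; exact.
by move=> [N _ hN]; exists N => // n /hN /= /ltW.
Qed.

Context {R : realType} {d : measure_display} {T : measurableType d}.
Variables (P : probability T R).
Variable F : {finite_measure set (measurableTypeR R) -> \bar R}.
Variable Z : set (measurableTypeR R) -> T -> R[i].
Hypothesis hZ : orthogonal_random_measure P F Z.
Implicit Types A B : set (measurableTypeR R).

Let L2Z A : measurable A -> complex_L2 P (Z A).
Proof. exact: (orm_L2 hZ). Qed.

(** Sigma-additivity applied to [A, B, set0, set0, ...].  The partial sums
    differ from [Z A + Z B] by multiples of [Z set0], whose second moment is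
    [F set0 = 0]; the distance to [Z (A `|` B)] is thus below every term of a
    sequence tending to [0], up to a factor [2]. *)
Lemma orm_additive A B : measurable A -> measurable B -> A `&` B = set0 ->
  sqnorm P (fun w => Z (A `|` B) w - (Z A w + Z B w))%R = 0%E.
Proof.
move=> mA mB AB0; set D := fun w => _.
have mAB : measurable (A `|` B) by exact: measurableU.
have mD : measurable_parts D.
  have LN C : measurable C -> complex_L2 P (fun w => (-1) * Z C w).
    by move=> mC; apply: complex_L2Z; exact: L2Z.
  have := complex_L2D (L2Z mAB) (complex_L2D (LN _ mA) (LN _ mB)).
  move=> /complex_L2_parts; congr measurable_parts.
  by apply/funext => w; rewrite /D opprD !mulN1r.
have mN (c : R[i]) : measurable_parts (fun w => c * Z set0 w).
  by apply: complex_L2_parts; apply: complex_L2Z; exact: L2Z.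
have Z0 : sqnorm P (Z set0) = 0%E.
  by rewrite /sqnorm (orm_control hZ)// measure0.
(* [V n] is the defect of the partial sum with [n + 2] terms. *)
pose V n w := Z (A `|` B) w - \sum_(k < n.+2) Z (bigcup2 A B k) w.
have VE n w : V n w = D w + (- n%:R) * Z set0 w.
  rewrite /V !big_ord_recl /= sumr_const card_ord /D -mulr_natl.
  by rewrite mulNr; ring.
have mV n : measurable_parts (V n).
  by have := measurable_partsD mD (mN (- n%:R)); under eq_fun do rewrite -VE.
have leD n : (sqnorm P D <= 2%:E * sqnorm P (V n))%E.
  have := sqnormD_le P ltr01 (mV n) (mN n%:R).
  rewrite sqnormZ; last by apply: complex_L2_parts; exact: L2Z.
  rewrite Z0 !mule0 adde0; congr (_ <= _)%E; congr sqnorm.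
  by apply/funext => w; rewrite VE mulNr addrNK.
apply/eqP; rewrite eq_le sqnorm_ge0 andbT.
apply/lee_addgt0Pr => e e0; rewrite add0e.
have e20 : 0 < e / 2 by rewrite divr_gt0.
have mu2 n : measurable (bigcup2 A B n).
  by rewrite /bigcup2; case: ifP => // _; case: ifP.
have tu2 : trivIset setT (bigcup2 A B) by rewrite -trivIset_bigcup2.
have cv := orm_sigma_additive hZ mu2 tu2; rewrite bigcup2E in cv.
have [N _ Ncv] := cvge0_near_le e20 cv.
have {}Ncv : (sqnorm P (V N) <= (e / 2)%:E)%E.
  by apply: (Ncv N.+2); rewrite /= -addn2 leq_addr.
apply: (le_trans (leD N)); apply: (le_trans (lee_wpmul2l _ Ncv)) => //.
by rewrite -EFinM lee_fin mulrCA divff ?mulr1.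
Qed.

(** With [A = (A `&` B) `|` (A `\` B)] and likewise for [B], orthogonality
    kills every cross term and leaves the second moment of
    [Z (A `&` B)]. *)
Lemma ip_orm A B : measurable A -> measurable B ->
  ip P (Z A) (Z B) = (fine (F (A `&` B)))%:C%C.
Proof.
move=> mA mB.
have ip_disj C D : measurable C -> measurable D -> C `&` D = set0 ->
  ip P (Z C) (Z D) = 0 by exact: (orm_orthogonal hZ).
have split_l C D (g : T -> R[i]) : measurable C -> measurable D ->
    complex_L2 P g ->
    ip P (Z C) g = ip P (Z (C `&` D)) g + ip P (Z (C `\` D)) g.
  move=> mC mD Lg; have [mI mCD] := (measurableI _ _ mC mD, measurableD mC mD).
  rewrite -[ip P (Z (C `&` D)) g]mul1r -ip_linear//; [|exact: L2Z..].
  apply: ip_ae_eql => //; [exact: L2Z| |].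
    by apply: complex_L2D; [apply: complex_L2Z|]; exact: L2Z.
  under [fun w => _ - _]eq_fun do rewrite mul1r.
  rewrite -{1}[C](setUIDK C D); apply: orm_additive => //.
  by rewrite setDE setIACA setICr setI0.
have [mI mAB mBA] := And3 (measurableI _ _ mA mB) (measurableD mA mB)
  (measurableD mB mA).
rewrite (split_l _ B)//; last exact: L2Z.
rewrite (ip_disj (A `\` B))// ?addr0; last exact: setDKI.
rewrite ip_conj; [|exact: L2Z..].
rewrite (split_l B A)//; last exact: L2Z.
rewrite (ip_disj (B `\` A))// ?addr0; last first.
  by rewrite setDE -setIA [~` A `&` _]setIA setICl set0I setI0.
rewrite setIC ip_self; last exact: L2Z.
by rewrite /sqnorm (orm_control hZ)// conjc_real.
Qed.

Lemma complex_L2_indic A : measurable A ->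
  complex_L2 F (fun l => (\1_A l : R)%:C%C).
Proof.
move=> mA; split.
- exact: measurable_indic.
- exact: measurable_cst.
- under eq_integral => l _.
    rewrite normc_sqr /= expr0n addr0 indicE -natrX.
    rewrite (_ : ((l \in A) ^ 2)%N = (l \in A)); last by case: (l \in A).
    rewrite -indicE; over.
  by rewrite integral_indic// setIT ltey_eq fin_num_measure.
Qed.

Lemma ip_indic A B : measurable A -> measurable B ->
  ip F (fun l => (\1_A l : R)%:C%C) (fun l => (\1_B l : R)%:C%C)
  = (fine (F (A `&` B)))%:C%C.
Proof.
move=> mA mB; rewrite /ip /Rintegral.
have E l : (\1_A l : R)%:C%C * ((\1_B l : R)%:C%C)^*%C
    = (\1_(A `&` B) l : R)%:C%C by rewrite conjc_real -rmorphM indicI.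
under eq_integral do rewrite E /=.
under [in X in (_ +i* X)%C]eq_integral do rewrite E /=.
rewrite integral0 integral_indic ?setIT//; exact: measurableI.
Qed.

Lemma measurable_repr_cons (p : R[i] * set (measurableTypeR R)) s :
  measurable_repr (p :: s) -> measurable p.2 /\ measurable_repr s.
Proof. by move=> m; split; [exact: (m 0%N)|move=> k; exact: (m k.+1)]. Qed.

Lemma complex_L2_simple_int (s : simple_repr R) : measurable_repr s ->
  complex_L2 P (simple_int Z s).
Proof.
elim: s => [_|p s IHs /measurable_repr_cons[mp ms]].
  by under [simple_int _ _]eq_fun do rewrite /simple_int big_nil;
     exact: complex_L20.
under [simple_int _ _]eq_fun do rewrite /simple_int big_cons.
by apply: complex_L2D; [apply: complex_L2Z; exact: L2Z|exact: IHs].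
Qed.

Lemma complex_L2_simple_fun (s : simple_repr R) : measurable_repr s ->
  complex_L2 F (simple_fun s).
Proof.
elim: s => [_|p s IHs /measurable_repr_cons[mp ms]].
  by under [simple_fun _]eq_fun do rewrite /simple_fun big_nil;
     exact: complex_L20.
under [simple_fun _]eq_fun do rewrite /simple_fun big_cons.
by apply: complex_L2D; [apply: complex_L2Z; exact: complex_L2_indic|exact: IHs].
Qed.

(** Linearity in the first argument extends to simple functions an equality of
    inner products known on sets.  Used once on each side, it turns the
    equality on pairs of sets into one on pairs of simple functions. *)
Lemma ip_simple_int_eq (g : T -> R[i]) (g' : measurableTypeR R -> R[i]) :
  complex_L2 P g -> complex_L2 F g' ->
  (forall A, measurable A ->
    ip P (Z A) g = ip F (fun l => (\1_A l : R)%:C%C) g') ->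
  forall s : simple_repr R, measurable_repr s ->
    ip P (simple_int Z s) g = ip F (simple_fun s) g'.
Proof.
move=> Lg Lg' eqZ; elim=> [_|p s IHs /measurable_repr_cons[mp ms]].
  under [simple_int _ _]eq_fun do rewrite /simple_int big_nil.
  by under [simple_fun _]eq_fun do rewrite /simple_fun big_nil; rewrite !ip0l.
under [simple_int _ _]eq_fun do rewrite /simple_int big_cons.
under [simple_fun _]eq_fun do rewrite /simple_fun big_cons.
rewrite !ip_linear//; [|exact: complex_L2_indic|exact: complex_L2_simple_fun|
  exact: L2Z|exact: complex_L2_simple_int].
by rewrite eqZ// IHs.
Qed.

Lemma ip_simple_int (s s' : simple_repr R) :
  measurable_repr s -> measurable_repr s' ->
  ip P (simple_int Z s) (simple_int Z s') = ip F (simple_fun s) (simple_fun s').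
Proof.
move=> ms ms'; apply: ip_simple_int_eq => //; [exact: complex_L2_simple_int|
  exact: complex_L2_simple_fun|].
move=> A mA; rewrite ip_conj; [|exact: complex_L2_simple_int|exact: L2Z].
rewrite [RHS]ip_conj; [|exact: complex_L2_simple_fun|exact: complex_L2_indic].
congr (_^*%C); apply: ip_simple_int_eq => //; [exact: L2Z|
  exact: complex_L2_indic|].
by move=> B mB; rewrite ip_orm// ip_indic.
Qed.

Lemma sqnorm_simple_int (s : simple_repr R) : measurable_repr s ->
  sqnorm P (simple_int Z s) = sqnorm F (simple_fun s).
Proof.
move=> ms; have := ip_simple_int ms ms.
have [LI LS] := (complex_L2_simple_int ms, complex_L2_simple_fun ms).
rewrite !ip_self// => -[eqs].
by rewrite -[LHS]fineK ?complex_L2_fin// eqs fineK// complex_L2_fin.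
Qed.

Definition simple_sub (s s' : simple_repr R) : simple_repr R :=
  s ++ [seq (- p.1, p.2) | p <- s'].

Lemma measurable_simple_sub (s s' : simple_repr R) :
  measurable_repr s -> measurable_repr s' -> measurable_repr (simple_sub s s').
Proof.
move=> ms ms' k; rewrite size_cat size_map nth_cat => kss'.
case: ltnP => ks; first exact: ms.
have kls' : (k - size s < size s')%N by rewrite ltn_subLR.
by rewrite (nth_map (0, set0))//; exact: ms'.
Qed.

Lemma simple_int_sub (s s' : simple_repr R) w :
  simple_int Z (simple_sub s s') w = simple_int Z s w - simple_int Z s' w.
Proof.
rewrite /simple_int big_cat big_map -sumrN; congr (_ + _).
by apply: eq_bigr => p _; rewrite mulNr.
Qed.

Lemma simple_fun_sub (s s' : simple_repr R) l :
  simple_fun (simple_sub s s') l = simple_fun s l - simple_fun s' l.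
Proof.
rewrite /simple_fun big_cat big_map -sumrN; congr (_ + _).
by apply: eq_bigr => p _; rewrite mulNr.
Qed.

Lemma sqdist_simple_int (s s' : simple_repr R) :
  measurable_repr s -> measurable_repr s' ->
  sqdist_L2 P (simple_int Z s) (simple_int Z s')
  = sqdist_L2 F (simple_fun s) (simple_fun s').
Proof.
move=> ms ms'; rewrite /sqdist_L2.
under [LHS]eq_integral do rewrite -simple_int_sub.
under [RHS]eq_integral do rewrite -simple_fun_sub.
by apply: sqnorm_simple_int; exact: measurable_simple_sub.
Qed.

(** Two applications of [sqdist_L2_perturb], on either side of the isometry for
    simple functions: from [X - Y] to the simple integrals in [L^2(P)], then
    from the simple functions back to [f - g] in [L^2(F)].  The errors vanish
    along the approximating sequences, which leaves the factor [(1 + e)^2]. *)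
Lemma stoch_integral_sqdist_le (f g : measurableTypeR R -> R[i])
    (X Y : T -> R[i]) :
  is_stoch_integral P F Z f X -> is_stoch_integral P F Z g Y ->
  (sqdist_L2 P X Y <= sqdist_L2 F f g)%E.
Proof.
move=> [Lf LX [s [ms sf sX]]] [Lg LY [s' [ms' s'g s'Y]]].
have [Lfg LXY] := (complex_L2B Lf Lg, complex_L2B LX LY).
rewrite -[leLHS]fineK ?complex_L2_fin// -[leRHS]fineK ?complex_L2_fin//.
set x := fine _; set y := fine _; rewrite lee_fin.
have y0 : 0 <= y by rewrite fine_ge0// sqnorm_ge0.
have key e dl : 0 < e -> 0 < dl ->
    x <= (1 + e) * ((1 + e) * y + (1 + e^-1) * (4 * dl)) + (1 + e^-1) * (4 * dl).
  move=> e0 dl0.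
  have e1 : 0 <= 1 + e by rewrite addr_ge0// ltW.
  have [n [[h1 h2] [h3 h4]]] := filter_ex (filterI
    (filterI (cvge0_near_le dl0 sf) (cvge0_near_le dl0 s'g))
    (filterI (cvge0_near_le dl0 sX) (cvge0_near_le dl0 s'Y))).
  have [LI LI'] := (complex_L2_simple_int (ms n), complex_L2_simple_int (ms' n)).
  have [LS LS'] := (complex_L2_simple_fun (ms n), complex_L2_simple_fun (ms' n)).
  have := sqdist_L2_perturb e0 LX LY LI LI' h3 h4.
  rewrite sqdist_simple_int//.
  rewrite sqdist_L2C in h1; rewrite sqdist_L2C in h2.
  have := sqdist_L2_perturb e0 LS LS' Lf Lg h1 h2.
  rewrite -[sqdist_L2 P X Y]fineK ?complex_L2_fin//.
  rewrite -[sqdist_L2 F f g]fineK ?complex_L2_fin// -/x -/y.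
  rewrite -!EFinM -!EFinD => hF hP; rewrite -lee_fin (le_trans hP)//.
  by rewrite !EFinD leeD2r// EFinM lee_wpmul2l// ?lee_fin// -EFinD.
have key2 e : 0 < e -> x <= (1 + e) ^+ 2 * y.
  move=> e0; apply/ler_addgt0Pr => r r0.
  (* [q] is the coefficient of the error in [key], so an error [r / q] costs [r]. *)
  pose q := (1 + e) * (1 + e^-1) * 4 + (1 + e^-1) * 4.
  have q0 : 0 < q by rewrite addr_gt0// !mulr_gt0// ?addr_gt0// invr_gt0.
  apply: (le_trans (key _ _ e0 (divr_gt0 r0 q0))).
  have -> : r = r / q * q by rewrite divfK// gt_eqF.
  by rewrite mulfK ?gt_eqF// /q; set t := r / _; rewrite le_eqVlt;
     apply/orP; left; apply/eqP; ring.
apply/ler_addgt0Pr => r r0.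
have q0 : 0 < 3 * y + r by rewrite ltr_wpDl// mulr_ge0.
(* For [e <= 1], [(1 + e)^2 y <= y + 3 e y]; this [e] makes [3 e y <= r]. *)
pose e := r / (3 * y + r).
have e0 : 0 < e by rewrite divr_gt0.
have e1 : e <= 1 by rewrite ler_pdivrMr// mul1r lerDr mulr_ge0.
have er : e * (3 * y + r) = r by rewrite divfK// gt_eqF.
apply: (le_trans (key2 _ e0)).
have ey0 : 0 <= e * y by rewrite mulr_ge0// ltW.
have er0 : 0 <= e * r by rewrite mulr_ge0// ltW.
have eey : 0 <= (1 - e) * (e * y) by rewrite mulr_ge0// subr_ge0.
nra.
Qed.

End orthogonal_measure.

(** * Increments of the complex exponential *)

Section phase.
Set Implicit Arguments.
Unset Strict Implicit.
Context {R : realType}.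
Implicit Types x y h beta : R.

(** The mean value theorem on [[0, x]], since [|cos| <= 1]. *)
Lemma abs_sin_le x : `|sin x| <= `|x|.
Proof.
wlog x0 : x / 0 <= x => [hw|].
  have [/hw//|/ltW x0] := leP 0 x.
  by rewrite -(normrN x) -(normrN (sin x)) -sinN hw// oppr_ge0.
have csin : {within `[0, x], continuous (@sin R)}.
  by apply: continuous_subspaceT => y; exact: continuous_sin.
have [c _] := @MVT_segment R sin cos 0 x x0 (fun y _ => is_derive_sin y) csin.
rewrite sin0 !subr0 => ->; rewrite normrM.
by rewrite -[leRHS]mul1r ler_wpM2r// cos_max.
Qed.

(** Interpolation between [|sin x| <= 1] and [|sin x| <= |x|]: the first serves
    for [|x| >= 1], the second for [|x| <= 1]. *)
Lemma abs_sin_powR_le x beta : 0 < beta -> beta <= 1 -> `|sin x| <= `|x| `^ beta.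
Proof.
move=> b0 b1; have [x1|/ltW x1] := leP 1 `|x|.
  apply: (le_trans (sin_max _)).
  rewrite [leLHS](_ : 1 = 1 `^ beta); last by rewrite powR1.
  by rewrite ge0_ler_powR ?nnegrE// ltW.
apply: (le_trans (abs_sin_le _)); have [->|x0] := eqVneq x 0.
  by rewrite normr0 powR_ge0.
by rewrite -[leLHS]powRr1// ger_powR// x1 andbT normr_gt0.
Qed.

(** The length of a chord of the unit circle. *)
Lemma normc_expiB x y :
  normc (expi x - expi y) ^+ 2 = 4 * sin ((x - y) / 2) ^+ 2.
Proof.
have -> : sin ((x - y) / 2) ^+ 2 = (1 - cos (x - y)) / 2.
  rewrite [in RHS](_ : x - y = (x - y) / 2 *+ 2).
    by rewrite cos_mulr2n cos2sin2; field.
  by rewrite -mulr_natr divfK.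
rewrite normc_sqr /= cosB.
have := cos2Dsin2 x; have := cos2Dsin2 y => cy cx.
by lra.
Qed.

Lemma normc_expiB_powR_le x y beta : 0 < beta -> beta <= 1 ->
  normc (expi x - expi y) ^+ 2
  <= (2 `^ (1 - beta)) ^+ 2 * `|x - y| `^ (2 * beta).
Proof.
move=> b0 b1; rewrite normc_expiB -real_normK ?num_real//.
have := abs_sin_powR_le ((x - y) / 2) b0 b1.
rewrite normrM [`|2^-1|]ger0_norm// powRM// => sle.
have -> : 2 `^ (1 - beta) = 2 * 2^-1 `^ beta :> R.
  rewrite powRB ?powRr1//; last by apply/implyP.
  by rewrite -(powR_inv1 (ler0n R 2)) -powRrM mulN1r powRN.
rewrite (mulrC 2 beta) powRrM powR_mulrn ?powR_ge0//.
rewrite !exprMn -natrX -mulrA ler_wpM2l// -exprMn.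
by rewrite [X in _ <= X ^+ 2]mulrC lerXn2r// ?nnegrE// mulr_ge0// powR_ge0.
Qed.

End phase.

(** * The Airy phase *)

Section airy.
Set Implicit Arguments.
Unset Strict Implicit.
Context {R : realType}.
Variable F : {finite_measure set (measurableTypeR R) -> \bar R}.

(** The point is that [l] and [l^3] have the same sign, so that
    [|l| + |l|^3 = |l + l^3|]. *)
Lemma airy_phase_le (l t x s y h : R) : `|t - s| <= h -> `|x - y| <= h ->
  `|(l * x + l ^+ 3 * t) - (l * y + l ^+ 3 * s)| <= h * `|l + l ^+ 3|.
Proof.
move=> ts xy.
have -> : `|l + l ^+ 3| = `|l| + `|l| ^+ 3.
  rewrite (_ : l + l ^+ 3 = l * (1 + l ^+ 2)); last by ring.
  rewrite normrM [`|1 + _|]ger0_norm ?addr_ge0 ?sqr_ge0//.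
  by rewrite mulrDr mulr1 -[l ^+ 2]real_normK ?num_real// -exprS.
have -> : (l * x + l ^+ 3 * t) - (l * y + l ^+ 3 * s)
    = l * (x - y) + l ^+ 3 * (t - s) by ring.
rewrite (le_trans (ler_normD _ _))// 2!normrM normrX [leRHS]mulrDr.
by rewrite ![h * _]mulrC lerD// ler_wpM2l.
Qed.

Lemma airy_sqdist_le (t x s y h beta : R) : 0 < beta -> beta <= 1 -> 0 < h ->
  `|t - s| <= h -> `|x - y| <= h ->
  (sqdist_L2 F (fun l => expi (l * x + l ^+ 3 * t)%R)
               (fun l => expi (l * y + l ^+ 3 * s)%R)
   <= ((2 `^ (1 - beta) * h `^ beta) ^+ 2)%:E *
      \int[F]_l (`|l + l ^+ 3| `^ (2 * beta))%:E)%E.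
Proof.
move=> b0 b1 h0 ts xy.
have mcomp (g f : R -> R) : measurable_fun [set: R] g ->
    measurable_fun [set: measurableTypeR R] f ->
    measurable_fun [set: measurableTypeR R] (fun l => g (f l)).
  by move=> mg mf; exact: (measurableT_comp mg mf).
have mpow : measurable_fun [set: measurableTypeR R]
    (fun l => `|l + l ^+ 3| `^ (2 * beta)).
  apply: (mcomp (@powR R ^~ (2 * beta)) (fun l => `|l + l ^+ 3|)).
    exact: measurable_powR.
  apply: mcomp; first exact: normr_measurable.
  by apply: measurable_funD => //; exact: measurable_funX.
have mphase z r : measurable_fun setT
    (fun l : measurableTypeR R => l * z + l ^+ 3 * r).
  by apply: measurable_funD; apply: measurable_funM => //; exact: measurable_funX.
have mpowE : measurable_fun [set: measurableTypeR R]
    (fun l => (`|l + l ^+ 3| `^ (2 * beta))%:E) by exact/measurable_EFinP.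
rewrite -ge0_integralZl_EFin ?sqr_ge0//.
apply: ge0_le_integral => //.
- by move=> l _; rewrite lee_fin sqr_ge0.
- apply/measurable_EFinP; under eq_fun do rewrite normc_expiB.
  apply: measurable_funM => //; apply: measurable_funX.
  apply: (mcomp (@sin R)).
    by apply: continuous_measurable_fun; exact: continuous_sin.
  by apply: measurable_funM => //; exact: measurable_funB.
- by apply/measurable_EFinP; apply: measurable_funM.
move=> l _; rewrite -EFinM lee_fin.
apply: (le_trans (normc_expiB_powR_le _ _ b0 b1)).
rewrite [in leRHS]exprMn -[leRHS]mulrA ler_wpM2l ?sqr_ge0//.
have -> : (h `^ beta) ^+ 2 = h `^ (2 * beta).
  by rewrite mulrC powRrM powR_mulrn// powR_ge0.
rewrite -powRM ?(ltW h0)//.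
by apply: ge0_ler_powR; rewrite ?nnegrE ?airy_phase_le// mulr_ge0// ltW.
Qed.

End airy.

Theorem theorem3p1 (R : realType) (d : measure_display)
    (T : measurableType d) (P : probability T R)
    (hP : measure_is_complete P)
    (eta : process P)
    (eta_meas : measurable_process eta)
    (eta_cont : ms_continuous eta)
    (eta_stat : weakly_stationary eta)
    (eta_cent : centered eta)
    (F : {finite_measure set (measurableTypeR R) -> \bar R})
    (hF : spectral_measure eta F)
    (Z : set (measurableTypeR R) -> T -> R[i])
    (hZ : orthogonal_random_measure P F Z)
    (eta_repr : spectral_representation eta F Z)
    (u : R -> R -> {RV P >-> R})
    (hu : airy_field F Z u)
    (hu0 : forall x : R, {ae P, forall w, u 0 x w = eta x w})
    (a b c d' : R) (ha : 0 <= a) (hab : a <= b) (hcd : c <= d')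
    (beta : R) (hbeta0 : 0 < beta) (hbeta1 : beta <= 1)
    (hmom : (\int[F]_l (`|l| `^ (6 * beta))%:E < +oo)%E)
    (h : R) (hh : 0 < h) :
  (ms_modulus u (`[a, b] `*` `[c, d']) h
     <= airy_const F beta * (h `^ beta)%:E)%E.
Proof.
apply: ge_ereal_sup => _ [t [x [s [y [[/= tab _] [/= sab _] ts xy ->]]]]].
have pos r : r \in `[a, b]%R -> 0 <= r.
  by rewrite in_itv /= => /andP[ar _]; exact: le_trans ha ar.
have := stoch_integral_sqdist_le hZ (hu t x (pos _ tab)) (hu s y (pos _ sab)).
move=> /le_trans /(_ (airy_sqdist_le F hbeta0 hbeta1 hh ts xy)).
have -> : sqdist_L2 P (fun w => (u t x w)%:C%C) (fun w => (u s y w)%:C%C)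
    = 'E_P[(fun w => (u t x w - u s y w) ^+ 2)%R]%E.
  rewrite unlock /sqdist_L2; apply: eq_integral => w _.
  by rewrite -rmorphB normc_sqr /= expr0n addr0.
set k := 2 `^ (1 - beta) * h `^ beta.
have k0 : 0 <= k by rewrite mulr_ge0// powR_ge0.
set I := (\int[F]_l _)%E => leI.
have I0 : (0 <= I)%E by apply: integral_ge0 => l _; rewrite lee_fin powR_ge0.
rewrite /airy_const -/I muleAC -EFinM -/k.
have -> : (k%:E * sqrte I)%E = sqrte ((k ^+ 2)%:E * I)%E.
  by rewrite sqrteM ?lee_fin ?sqr_ge0//= sqrtr_sqr ger0_norm.
by rewrite lee_sqrt// mule_ge0// lee_fin sqr_ge0.
Qed.
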